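(* Let $a\colon\mathbb{R}\to(0,\infty)$ be a locally bounded differentiable function with locally bounded derivative such that $\int_0^\infty a(x)^{-1}\,dx=\infty=\int_{-\infty}^0 a(x)^{-1}\,dx$, and let $\rho\colon\mathbb{R}\to(0,\infty)$ be a $C^\infty$-function. Let $d(x;y)=\big|\int_x^y a(z)^{-1}\,dz\big|$ for $x,y\in\mathbb{R}$, and for $x\in\mathbb{R}$, $r>0$ let $$V(x;r)=\int_{\{y\in\mathbb{R}\,:\,d(x;y)<r\}}\rho(y)\,dy .$$ (I) Let $C\ge1$ and $\omega\ge0$ be such that $$a(y)\rho(y)\le C\,e^{\omega d(x;y)}\,a(x)\rho(x)\quad\text{for all }x,y\in\mathbb{R}.$$ Then $V(x;2r)\le2\,C^2\,e^{3\omega}\,V(x;r)$ for all $x\in\mathbb{R}$ and $r\in(0,1]$. Moreover, if $\omega=0$ then this inequality is valid for all $x\in\mathbb{R}$ and $r>0$. (II) If there exist $c>0$ and a function $v\colon(0,\infty)\to\mathbb{R}$ such that $$c^{-1}v(r)\le V(x;r)\le c\,v(r)$$ for all $x\in\mathbb{R}$ and $r\in(0,1]$, then there is a $C\ge1$ such that $a(y)\rho(y)\le C\,a(x)\rho(x)$ for all $x,y\in\mathbb{R}$.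
   Context: All objects are defined in the claim. The function $d$ is the distance on $\mathbb{R}$ associated with the vector field $X=a\,d/dx$, and $V(x;r)$ is the $\rho\,dx$-measure of the ball of radius $r$ centred at $x$ for this distance. *)

(* Defs.v *)
From HB Require Import structures.
From mathcomp Require Import all_boot all_order all_algebra.
From mathcomp Require Import all_classical all_reals all_analysis.

Set Implicit Arguments.
Unset Strict Implicit.
Unset Printing Implicit Defensive.

Import Order.TTheory GRing.Theory Num.Theory.
Import numFieldNormedType.Exports.

Local Open Scope classical_set_scope.
Local Open Scope ring_scope.

(* The underlying Lebesgue integrals are finite for f continuous, the only
   case in which the definition is used; [Rintegral] sends infinite or
   undefined integrals to 0. *)
Definition oriented_integral {R : realType} (f : R -> R) (x y : R) : R :=
  if x <= y then \int[@lebesgue_measure R]_(z in `[x, y]) f z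
  else - \int[@lebesgue_measure R]_(z in `[y, x]) f z.

Definition dist {R : realType} (a : R -> R) (x y : R) : R :=
  `|oriented_integral (fun z => (a z)^-1) x y|.

Definition dball {R : realType} (a : R -> R) (x r : R) : set R :=
  [set y | dist a x y < r].

Definition volume {R : realType} (a rho : R -> R) (x r : R) : \bar R :=
  (\int[@lebesgue_measure R]_(y in dball a x r) (rho y)%:E)%E.

Definition smooth {R : realType} (f : R -> R) : Prop :=
  forall (n : nat) (x : R), derivable (derive1n n f) x 1.

(* Main.v *)
(* By continuity and the divergence of the integrals of 1/a, every ball of
   radius r is an interval on which 1/a has integral exactly 2r. Since
   rho = (a rho) / a, bounds k <= a rho <= K on the ball give
   2 r k <= V(x; r) <= 2 r K.  For (I) this is applied on the balls of radius r
   and 2r with the bounds coming from the growth hypothesis.  For (II),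
   V(x; r) / (2r) tends to a(x) rho(x) as r -> 0, while the hypothesis gives
   V(y; r) <= c^2 V(x; r). *)
Require Import Defs.
From HB Require Import structures.
From mathcomp Require Import all_boot all_order all_algebra.
From mathcomp Require Import all_classical all_reals all_analysis.
From mathcomp Require Import measurable_realfun ring lra.

Set Implicit Arguments.
Unset Strict Implicit.
Unset Printing Implicit Defensive.

Import Order.TTheory GRing.Theory Num.Theory.
Import numFieldNormedType.Exports.

Local Open Scope classical_set_scope.
Local Open Scope ring_scope.


Local Notation mu := (@lebesgue_measure _).

(** * Integrals of a positive continuous function over intervals *)

Section positive_density.
Context {R : realType}.
Implicit Types (g : R -> R) (x y z p q r K : R).

Lemma continuous_integrable_itv g x y : continuous g ->
  mu.-integrable `[x, y] (EFin \o g).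
Proof.
move=> cg; apply: continuous_compact_integrable; first exact: segment_compact.
exact: continuous_subspaceT.
Qed.

Lemma Rintegral_itv_cat g x y z : continuous g -> x <= y -> y <= z ->
  \int[mu]_(t in `[x, z]) g t =
  \int[mu]_(t in `[x, y]) g t + \int[mu]_(t in `[y, z]) g t.
Proof.
move=> cg xy yz.
have ig u v := @continuous_integrable_itv g u v cg.
(* The point [y] is null, so the second piece may be made open at [y]; it is then the difference of
   the other two. *)
rewrite -(@Rintegral_itv_obnd_cbnd _ y); last first.
  by apply: integrableS (ig y z) => //; apply: subset_itvr; rewrite bnd_simp.
rewrite -(@Rintegral_itvB _ g (BLeft x) (BRight z)) ?bnd_simp//.
by rewrite addrC subrK.
Qed.

(** On a compact interval [g] attains its minimum, which is positive; the integral is at least this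
    minimum times the length. *)
Lemma Rintegral_itv_gt0 g x y : continuous g -> (forall t, 0 < g t) -> x < y ->
  0 < \int[mu]_(t in `[x, y]) g t.
Proof.
move=> cg g0 xy.
have [m _ gm] := @EVT_min R g x y (ltW xy) (continuous_subspaceT cg).
apply: (@lt_le_trans _ _ (g m * (y - x))); first by rewrite mulr_gt0// subr_gt0.
have -> : g m * (y - x) = \int[mu]_(t in `[x, y]) (cst (g m) t).
  by rewrite Rintegral_cst//= lebesgue_measure_itv/= lte_fin xy.
apply: le_Rintegral => //.
- by apply: continuous_integrable_itv => t; exact: cvg_cst.
- exact: continuous_integrable_itv.
Qed.

Lemma Rintegral_itv_le g x y z : continuous g -> (forall t, 0 < g t) ->
  x <= y -> y <= z ->
  \int[mu]_(t in `[x, y]) g t <= \int[mu]_(t in `[x, z]) g t.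
Proof.
move=> cg g0 xy yz; rewrite (Rintegral_itv_cat cg xy yz) lerDl.
by apply: Rintegral_ge0 => t _; exact: ltW.
Qed.

(** An equality of booleans, so that rewriting turns comparisons of distances into comparisons of
    endpoints. *)
Lemma Rintegral_itv_ltl g x y z : continuous g -> (forall t, 0 < g t) ->
  x <= y -> x <= z ->
  (\int[mu]_(t in `[x, y]) g t < \int[mu]_(t in `[x, z]) g t) = (y < z).
Proof.
move=> cg g0 xy xz; have [yz|zy] := ltP y z; last first.
  by apply/negbTE; rewrite -leNgt Rintegral_itv_le.
by rewrite (Rintegral_itv_cat cg xy (ltW yz)) ltrDl Rintegral_itv_gt0.
Qed.

Lemma Rintegral_itv_ltr g x y z : continuous g -> (forall t, 0 < g t) ->
  y <= x -> z <= x ->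
  (\int[mu]_(t in `[y, x]) g t < \int[mu]_(t in `[z, x]) g t) = (z < y).
Proof.
move=> cg g0 yx zx; have [zy|yz] := ltP z y.
  by rewrite (Rintegral_itv_cat cg (ltW zy) yx) ltrDr Rintegral_itv_gt0.
apply/negbTE; rewrite -leNgt (Rintegral_itv_cat cg yz zx) lerDr.
by apply: Rintegral_ge0 => t _; exact: ltW.
Qed.

(** Monotone convergence along the intervals [[0, n]], whose union is the half-line. *)
Lemma Rintegral_itv_unbounded g M : continuous g -> (forall t, 0 < g t) ->
  (\int[mu]_(t in `[0%R, +oo[) (g t)%:E = +oo)%E ->
  exists2 y, 0 <= y & M <= \int[mu]_(t in `[0, y]) g t.
Proof.
move=> cg g0 ginf.
pose F (n : nat) := `[0, n%:R]%classic : set R.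
have FU : \bigcup_n F n = `[0%R, +oo[%classic.
  apply/seteqP; split => t /=.
    by move=> [n _]; rewrite /F/= !in_itv/= andbT => /andP[].
  rewrite in_itv/= andbT => t0; exists (Num.truncn t).+1 => //.
  by rewrite /F/= in_itv/= t0/= ltW// truncnS_gt.
have mF n : measurable (F n) by exact: measurable_itv.
have := @ge0_nondecreasing_set_cvg_integral _ (measurableTypeR R) R F
  (EFin \o g) mu.
rewrite FU /= ginf => cvF.
have /cvgeyPge/(_ M)[n _ /(_ n (leqnn n))/=] :
    (\int[mu]_(t in F i) (g t)%:E)%E @[i --> \oo] --> +oo%E.
  apply: cvF => //.
  - move=> i j ij; rewrite subsetEset => t.
    rewrite /F/= !in_itv/= => /andP[-> /le_trans]; apply.
    by rewrite ler_nat.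
  - move=> i; apply/measurable_EFinP/measurable_funTS.
    exact: continuous_measurable_fun.
  - by move=> i t _; rewrite lee_fin ltW.
rewrite -(fineK (integrable_fin_num _ (continuous_integrable_itv 0 n%:R cg)))//.
by rewrite lee_fin => Mn; exists n%:R.
Qed.

Lemma exists_Rintegral_itv_eqr g x r : continuous g -> (forall t, 0 < g t) ->
  (\int[mu]_(t in `[0%R, +oo[) (g t)%:E = +oo)%E -> 0 < r ->
  exists2 q, x < q & \int[mu]_(t in `[x, q]) g t = r.
Proof.
move=> cg g0 ginf r0.
(* Divergence is known from 0 on, whereas [x] may have either sign; beyond [m] both starting points
   can be compared. *)
pose m := Num.max x 0.
have xm : x <= m by rewrite le_max lexx.
have m0 : 0 <= m by rewrite le_max lexx orbT.
have [n n0 rn] := Rintegral_itv_unbounded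
  (r + \int[mu]_(t in `[0, m]) g t) cg g0 ginf.
have mn : m < n.
  by rewrite -(@Rintegral_itv_ltl g 0)// (lt_le_trans _ rn)// ltrDr.
have xn : x <= n by rewrite (le_trans xm)// ltW.
have rxn : r <= \int[mu]_(t in `[x, n]) g t.
  rewrite (Rintegral_itv_cat cg xm (ltW mn)).
  move: rn; rewrite (Rintegral_itv_cat cg m0 (ltW mn)) addrC lerD2l => rmn.
  rewrite (le_trans rmn)// lerDr.
  by apply: Rintegral_ge0 => t _; exact: ltW.
have [|q] := @IVT R (fun y => \int[mu]_(t in `[x, y]) g t) x n r xn
  (parameterized_integral_continuous xn (continuous_integrable_itv x n cg)).
  by rewrite set_itv1 Rintegral_set1 ge_min ltW//= le_max rxn orbT.
(* The intermediate value theorem only gives [x <= q]; equality would make the integral 0, against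
   [0 < r]. *)
rewrite in_itv/= le_eqVlt => /andP[/predU1P[xq|xq] _] qr; last by exists q.
by move: r0; rewrite -qr -xq set_itv1 Rintegral_set1 ltxx.
Qed.

(** Follows from the right-hand case by the reflection [t -> - t]. *)
Lemma exists_Rintegral_itv_eql g x r : continuous g -> (forall t, 0 < g t) ->
  (\int[mu]_(t in `]-oo, 0%R]) (g t)%:E = +oo)%E -> 0 < r ->
  exists2 p, p < x & \int[mu]_(t in `[p, x]) g t = r.
Proof.
move=> cg g0 ginf r0.
have cgN : continuous (g \o -%R).
  by move=> t; apply: continuous_comp; [exact: opp_continuous|exact: cg].
have [||q xq <-] := @exists_Rintegral_itv_eqr (g \o -%R) (- x) r cgN _ _ r0.
- by move=> t; exact: g0.
- rewrite -ge0_integration_by_substitutionNy ?oppr0//.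
    exact: continuous_subspaceT.
  by move=> t _; exact: ltW.
exists (- q); first by rewrite ltrNl.
rewrite /Rintegral -integration_by_substitution_oppr ?opprK ?ltW//.
exact: continuous_subspaceT.
Qed.

End positive_density.

(** * Balls of the distance, as intervals *)

Section geometry.
Context {R : realType} (a : R -> R).
Hypothesis a_gt0 : forall x, 0 < a x.
Hypothesis a_cont : continuous a.
Implicit Types (x y p q r d e c C omega K : R).

Let g z := (a z)^-1.

Let g_gt0 z : 0 < g z. Proof. by rewrite invr_gt0. Qed.

Let g_cont : continuous g.
Proof. by move=> z; apply: cvgV; [rewrite gt_eqF|exact: a_cont]. Qed.

Lemma dist_le x y : x <= y -> dist a x y = \int[mu]_(z in `[x, y]) (a z)^-1.
Proof.
move=> xy; rewrite /dist /oriented_integral xy ger0_norm//.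
by apply: Rintegral_ge0 => z _; rewrite ltW// g_gt0.
Qed.

Lemma distC x y : dist a x y = dist a y x.
Proof.
rewrite /dist /oriented_integral.
by have [xy|yx|->] := ltgtP x y; rewrite ?normrN.
Qed.

Lemma dist_gt0 x y : x < y -> 0 < dist a x y.
Proof. by move=> xy; rewrite dist_le ?ltW// Rintegral_itv_gt0. Qed.

(** The distance to [x] is strictly monotone on each side of [x], so the two points at distance [r]
    delimit the ball. *)
Lemma dball_itv x r p q : p < x -> x < q ->
  dist a p x = r -> dist a x q = r -> dball a x r = `]p, q[%classic.
Proof.
move=> px xq; rewrite !dist_le ?ltW// => dp dq.
apply/seteqP; split => y; rewrite /dball/= in_itv/=.
all: have [xy|yx] := leP x y.
- by rewrite dist_le// -dq Rintegral_itv_ltl ?(ltW xq)// (lt_le_trans px xy).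
- rewrite distC dist_le ?ltW// -dp Rintegral_itv_ltr ?(ltW px) ?(ltW yx)// => ->.
  exact: lt_trans xq.
- by rewrite dist_le// -dq Rintegral_itv_ltl ?(ltW xq)// => /andP[].
- rewrite distC dist_le ?ltW// -dp Rintegral_itv_ltr ?(ltW px) ?(ltW yx)//.
  by move=> /andP[].
Qed.

(** Small balls lie in ordinary neighbourhoods of the centre, which lets continuity at [x] act on
    them; [r0] is the distance to the nearer of [x - d] and [x + d]. *)
Lemma dball_sub_itv x d : 0 < d -> exists2 r0, 0 < r0 &
  forall r, r <= r0 -> dball a x r `<=` `]x - d, x + d[.
Proof.
move=> d0.
have xl : x - d < x by rewrite ltrBlDr ltrDl.
have xr : x < x + d by rewrite ltrDl.
exists (Num.min (dist a (x - d) x) (dist a x (x + d))).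
  by rewrite lt_min !dist_gt0.
move=> r; rewrite le_min => /andP[rl rr] y; rewrite /dball/= in_itv/=.
have [xy|yx] := leP x y => dr.
- rewrite (lt_le_trans xl xy)/=; move: (lt_le_trans dr rr).
  by rewrite !dist_le ?(ltW xr)// Rintegral_itv_ltl ?(ltW xr).
- rewrite (lt_trans yx xr) andbT; move: (lt_le_trans dr rl).
  rewrite distC !dist_le ?(ltW xl) ?(ltW yx)//.
  by rewrite Rintegral_itv_ltr ?(ltW xl) ?(ltW yx).
Qed.

Hypothesis a_pinfty :
  (\int[mu]_(x in `[0%R, +oo[) ((a x)^-1)%:E = +oo)%E.
Hypothesis a_ninfty :
  (\int[mu]_(x in `]-oo, 0%R]) ((a x)^-1)%:E = +oo)%E.

(** Each half of the ball contributes [r] to the integral of [1 / a]. The function [K / a] is the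
    one to which [rho] gets compared. *)
Lemma integral_dball x r K : 0 < r -> 0 <= K ->
  measurable (dball a x r) /\
  (\int[mu]_(y in dball a x r) (K / a y)%:E = (K * (2 * r))%:E)%E.
Proof.
move=> r0 K0.
have [q xq qr] := exists_Rintegral_itv_eqr x g_cont g_gt0 a_pinfty r0.
have [p px pr] := exists_Rintegral_itv_eql x g_cont g_gt0 a_ninfty r0.
have -> : dball a x r = `]p, q[%classic.
  by apply: dball_itv; rewrite // dist_le ?ltW.
split; first exact: measurable_itv.
have mg (D : set R) : measurable_fun D g.
  apply: measurable_funTS; exact: continuous_measurable_fun.
under eq_integral do rewrite EFinM.
rewrite ge0_integralZl//; last 2 first.
- by apply/measurable_EFinP; exact: mg.
- by move=> y _; rewrite lee_fin ltW// g_gt0.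
(* Adding the two null endpoints gives a compact interval, on which the integral is finite and
   splits at [x]. *)
rewrite -(@integral_itv_bndoo _ _ _ _ true false); last first.
  by apply/measurable_EFinP; exact: mg.
rewrite -(fineK (integrable_fin_num _ (continuous_integrable_itv p q g_cont)))//.
rewrite -EFinM; congr (_ * _)%:E.
have /= := Rintegral_itv_cat g_cont (ltW px) (ltW xq).
by rewrite pr qr -mulr2n mulr_natl => <-.
Qed.

(** * Volume bounds, doubling, and comparison of densities *)

Variable rho : R -> R.
Hypothesis rho_gt0 : forall x, 0 < rho x.
Hypothesis rho_cont : continuous rho.

Let mrho (D : set R) : measurable_fun D (EFin \o rho).
Proof.
apply/measurable_EFinP; apply: measurable_funTS.
exact: continuous_measurable_fun.
Qed.

Let mKg K (D : set R) : measurable_fun D (fun y => (K / a y)%:E).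
Proof.
apply/measurable_EFinP; apply: measurable_funTS; apply: measurable_funM => //.
exact: continuous_measurable_fun.
Qed.

Lemma volume_le x r K : 0 < r -> 0 <= K ->
  (forall y, dist a x y < r -> a y * rho y <= K) ->
  (volume a rho x r <= (K * (2 * r))%:E)%E.
Proof.
move=> r0 K0 hK; have [mD <-] := integral_dball x r0 K0.
apply: ge0_le_integral => //.
- by move=> y _; rewrite lee_fin ltW.
- exact: mrho.
- exact: mKg.
- by move=> y /hK; rewrite lee_fin ler_pdivlMr// mulrC.
Qed.

Lemma volume_ge x r K : 0 < r -> 0 <= K ->
  (forall y, dist a x y < r -> K <= a y * rho y) ->
  ((K * (2 * r))%:E <= volume a rho x r)%E.
Proof.
move=> r0 K0 hK; have [mD <-] := integral_dball x r0 K0.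
apply: ge0_le_integral => //.
- by move=> y _; rewrite lee_fin divr_ge0// ltW.
- exact: mKg.
- exact: mrho.
- by move=> y /hK; rewrite lee_fin ler_pdivrMr// mulrC.
Qed.

(** With [h = a x * rho x] and [E = expR (omega * r)], the density is at most [C * E ^+ 2 * h] on
    the large ball and at least [h / (C * E)] on the small one. The condition [omega * r <= omega]
    covers both [r <= 1] and [omega = 0]. *)
Lemma volume_doubling C omega x r : 1 <= C -> 0 <= omega ->
  (forall x y : R,
      a y * rho y <= C * expR (omega * dist a x y) * (a x * rho x)) ->
  0 < r -> omega * r <= omega ->
  (volume a rho x (2 * r)
     <= (2 * C ^+ 2 * expR (3 * omega))%:E * volume a rho x r)%E.
Proof.
move=> C1 w0 growth r0 wr.
have C0 : 0 < C by exact: lt_le_trans C1.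
have [h hE h0] : exists2 h, h = a x * rho x & 0 < h.
  by exists (a x * rho x); rewrite // mulr_gt0.
pose E := expR (omega * r).
have E0 : 0 < E by exact: expR_gt0.
have up : (volume a rho x (2 * r)
    <= (C * E ^+ 2 * h * (2 * (2 * r)))%:E)%E.
  apply: volume_le; rewrite ?mulr_gt0 ?mulr_ge0 ?exprn_ge0//;
    rewrite ?(ltW C0) ?(ltW E0) ?(ltW h0)//.
  move=> y xy; apply: (le_trans (growth x y)).
  rewrite -hE ler_pM2r// ler_pM2l// /E -expRM_natl ler_expR mulrCA.
  by rewrite ler_wpM2l// ltW// mulr_natl -mulr_natl.
have lo : ((h / (C * E) * (2 * r))%:E <= volume a rho x r)%E.
  apply: volume_ge; rewrite ?divr_ge0 ?mulr_ge0 ?(ltW C0) ?(ltW E0) ?(ltW h0)//.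
  move=> y xy; rewrite hE ler_pdivrMr ?mulr_gt0// [leRHS]mulrC.
  (* The lower bound is the growth hypothesis with the two points exchanged. *)
  apply: (le_trans (growth y x)).
  rewrite ler_pM2r ?mulr_gt0// ler_pM2l// ler_expR.
  by rewrite ler_wpM2l// distC ltW.
apply: (le_trans up).
have K0 : 0 <= 2 * C ^+ 2 * expR (3 * omega).
  by rewrite !mulr_ge0 ?exprn_ge0 ?expR_ge0// ltW.
apply: (@le_trans _ _ ((2 * C ^+ 2 * expR (3 * omega))%:E *
    (h / (C * E) * (2 * r))%:E)%E); last first.
  by rewrite lee_wpmul2l// lee_fin.
rewrite -EFinM lee_fin.
have EE : E ^+ 3 <= expR (3 * omega).
  by rewrite /E -expRM_natl ler_expR ler_wpM2l.
(* The quotient of the two bounds: 2 from the radii, [C ^+ 2 * E ^+ 3] from the densities. *)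
have -> : C * E ^+ 2 * h * (2 * (2 * r)) =
    2 * C ^+ 2 * E ^+ 3 * (h / (C * E) * (2 * r)).
  by field; rewrite !gt_eqF.
rewrite ler_pM2r; first by rewrite ler_pM2l// mulr_gt0 ?exprn_gt0.
by rewrite !mulr_gt0 ?invr_gt0 ?mulr_gt0.
Qed.

(** An explicit form of the limit of [V(x; r) / (2r)], by continuity of [a * rho] at [x]. The bound
    on [e] keeps the lower constant nonnegative, as [volume_ge] requires. *)
Lemma exists_volume_bounds x e : 0 < e -> e <= a x * rho x ->
  exists2 r0, 0 < r0 & forall r, 0 < r -> r <= r0 ->
    (((a x * rho x - e) * (2 * r))%:E <= volume a rho x r)%E /\
    (volume a rho x r <= ((a x * rho x + e) * (2 * r))%:E)%E.
Proof.
move=> e0 eh.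
have hc : {for x, continuous (fun y => a y * rho y)}.
  by apply: cvgM; [exact: a_cont|exact: rho_cont].
have /cvgrPdist_le/(_ _ e0) [d /= d0 hd] := hc.
have [r0 r00 sub] := dball_sub_itv x d0.
exists r0 => // r rgt0 rr0.
have close y : dist a x y < r -> `|a x * rho x - a y * rho y| <= e.
  move=> xy; apply: hd => /=.
  have := sub r rr0 y xy; rewrite /= in_itv/= => /andP[yl yr].
  by rewrite ltr_norml; apply/andP; split; lra.
split.
- apply: volume_ge => //; first by rewrite subr_ge0.
  by move=> y /close; rewrite ler_norml => /andP[_]; lra.
- apply: volume_le => //; first by rewrite addr_ge0 ?(ltW e0) ?mulr_ge0 ?ltW.
  by move=> y /close; rewrite ler_norml => /andP[+ _]; lra.
Qed.

Lemma density_comparable c (v : R -> R) x y : 0 < c ->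
  (forall x r, 0 < r -> r <= 1 ->
     ((c^-1 * v r)%:E <= volume a rho x r)%E /\
     (volume a rho x r <= (c * v r)%:E)%E) ->
  a y * rho y <= c ^+ 2 * (a x * rho x).
Proof.
move=> c0 hv.
have hx0 : 0 < a x * rho x by rewrite mulr_gt0.
have hy0 : 0 < a y * rho y by rewrite mulr_gt0.
set hx := a x * rho x in hx0 *; set hy := a y * rho y in hy0 *.
(* At one radius small enough for both points, [v r] is eliminated between the upper bound at [y]
   and the lower bound at [x]; then [2 * r] cancels. *)
have bound e : 0 < e -> e <= hx -> e <= hy -> hy - e <= c ^+ 2 * (hx + e).
  move=> e0 ex ey.
  have [rx rx0 vx] := exists_volume_bounds e0 ex.
  have [ry ry0 vy] := exists_volume_bounds e0 ey.
  pose r := Num.min 1 (Num.min rx ry).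
  have r0 : 0 < r by rewrite !lt_min ltr01 rx0.
  have [r1 rrx rry] : [/\ r <= 1, r <= rx & r <= ry].
    by rewrite !ge_min !lexx !orbT.
  have := le_trans (vy r r0 rry).1 (hv y r r0 r1).2.
  have := le_trans (hv x r r0 r1).1 (vx r r0 rrx).2.
  rewrite !lee_fin ler_pdivrMl// => vlo vup.
  rewrite -(ler_pM2r (mulr_gt0 (ltr0Sn R 1) r0)).
  by apply: (le_trans vup); rewrite expr2 -!mulrA ler_pM2l//.
rewrite leNgt; apply/negP => lt.
have c20 : 0 < c ^+ 2 by rewrite exprn_gt0.
(* [bound] says [hy - c ^+ 2 * hx <= e * (1 + c ^+ 2)]; the last term in the minimum makes the right
   side at most half of the positive left side. *)
pose e := Num.min (Num.min hx hy) ((hy - c ^+ 2 * hx) / (2 * (1 + c ^+ 2))).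
have d0 : 0 < (hy - c ^+ 2 * hx) / (2 * (1 + c ^+ 2)).
  by rewrite divr_gt0 ?subr_gt0// mulr_gt0// addr_gt0.
have e0 : 0 < e by rewrite !lt_min hx0 hy0.
have [ex ey] : e <= hx /\ e <= hy by rewrite !ge_min !lexx !orbT.
have : e <= (hy - c ^+ 2 * hx) / (2 * (1 + c ^+ 2)).
  by rewrite ge_min lexx orbT.
rewrite ler_pdivlMr ?mulr_gt0 ?addr_gt0//.
have := bound e e0 ex ey; nra.
Qed.

End geometry.

Theorem proposition5p1 (R : realType) (a rho : R -> R)
  (a_gt0 : forall x, 0 < a x)
  (a_bnd : [locally [bounded a x | x in [set: R]]])
  (a_drv : forall x, derivable a x 1)
  (da_bnd : [locally [bounded derive1 a x | x in [set: R]]])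
  (a_pinfty : (\int[@lebesgue_measure R]_(x in `[0%R, +oo[) ((a x)^-1)%:E
                = +oo)%E)
  (a_ninfty : (\int[@lebesgue_measure R]_(x in `]-oo, 0%R]) ((a x)^-1)%:E
                = +oo)%E)
  (rho_gt0 : forall x, 0 < rho x)
  (rho_smooth : smooth rho) :
  (forall C omega : R, 1 <= C -> 0 <= omega ->
     (forall x y : R,
        a y * rho y <= C * expR (omega * dist a x y) * (a x * rho x)) ->
     (forall x r : R, 0 < r -> r <= 1 ->
        (volume a rho x (2 * r)
           <= (2 * C ^+ 2 * expR (3 * omega))%:E * volume a rho x r)%E)
     /\
     (omega = 0 ->
        forall x r : R, 0 < r ->
        (volume a rho x (2 * r)
           <= (2 * C ^+ 2 * expR (3 * omega))%:E * volume a rho x r)%E))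
  /\
  ((exists (c : R) (v : R -> R), 0 < c /\
      forall x r : R, 0 < r -> r <= 1 ->
        ((c^-1 * v r)%:E <= volume a rho x r)%E /\
        (volume a rho x r <= (c * v r)%:E)%E) ->
   exists C : R, 1 <= C /\
     forall x y : R, a y * rho y <= C * (a x * rho x)).
Proof.
have a_cont : continuous a.
  by move=> x; apply/differentiable_continuous/derivable1_diffP.
have rho_cont : continuous rho.
  by move=> x; apply/differentiable_continuous/derivable1_diffP/(rho_smooth 0%N).
split.
  (* Either way [omega * r <= omega]: by [r <= 1], or because both sides are 0. *)
  move=> C omega C1 w0 growth; split=> [x r r0 r1|wE x r r0].
    by apply: volume_doubling => //; rewrite -[leRHS]mulr1 ler_wpM2l.
  by apply: volume_doubling => //; rewrite wE mul0r.
(* The comparison constant is [c ^+ 2]; the maximum secures [1 <= C]. *)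
move=> [c [v [c0 hv]]]; exists (Num.max 1 (c ^+ 2)); split.
  by rewrite le_max lexx.
move=> x y; apply: (@le_trans _ _ (c ^+ 2 * (a x * rho x))).
  exact: (density_comparable a_gt0 a_cont a_pinfty a_ninfty rho_gt0
    rho_cont x y c0 hv).
by rewrite ler_pM2r ?mulr_gt0// le_max lexx orbT.
Qed.
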